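(* For every $n\ge1$ and partition $\lambda\subseteq\delta_n$, the polytope $\mathcal{P}_\lambda(n)$ is a face of $\mathcal{A}(n)$ of dimension $\binom{n}{2}-|\lambda|$. In particular, $\mathcal{P}_\varnothing(n)=\mathcal{ASMCRY}(n)$ is a face of $\mathcal{A}(n)$ of dimension $\binom n2$.
   Context: $\mathcal{A}(n)$ is the set of real $n\times n$ matrices $(a_{ij})$ with $0\le\sum_{i=1}^{i'}a_{ij}\le1$ for all $1\le i',j\le n$, $0\le\sum_{j=1}^{j'}a_{ij}\le1$ for all $1\le j',i\le n$, and all full row and column sums equal to $1$ (the alternating sign matrix polytope). $\delta_n=(n-1,\dots,1)$; a partition $\lambda=(\lambda_1,\dots,\lambda_k)\subseteq\delta_n$ (i.e. $\lambda_i\le n-i$) is identified with the set of positions $\{(i,j):1\le i\le k,\ n-\lambda_i+1\le j\le n\}$, and $|\lambda|=\sum_i\lambda_i$. $\mathcal{P}_\lambda(n)=\{(a_{ij})\in\mathcal{A}(n):a_{ij}=0 \text{ whenever } i-j\ge2 \text{ and whenever }(i,j)\in\lambda\}$, and $\mathcal{ASMCRY}(n)=\mathcal{P}_\varnothing(n)$. *)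

(* Defs.v *)
From HB Require Import structures.
From mathcomp Require Import all_boot all_order all_algebra.
From mathcomp Require Import classical_sets reals.

Set Implicit Arguments.
Unset Strict Implicit.
Unset Printing Implicit Defensive.

Import Order.TTheory GRing.Theory Num.Theory.

Local Open Scope classical_set_scope.
Local Open Scope ring_scope.

Definition affine_hull (R : realType) (V : vectType R) (S : set V) : set V :=
  [set x | exists (k : nat) (p : 'I_k -> V) (c : 'I_k -> R),
    [/\ forall i, S (p i), \sum_(i < k) c i = 1 &
        x = \sum_(i < k) c i *: p i]].

(* The affine hull of S is the translate x0 + U of a linear subspace U of
   dimension d; in particular S is nonempty. *)
Definition has_dim (R : realType) (V : vectType R) (S : set V) (d : nat) :=
  exists (x0 : V) (U : {vspace V}),
    affine_hull S = [set x | x - x0 \in U] /\ \dim U = d.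

(* The improper faces are included: P itself (f = 0, b = 0) and the empty set. *)
Definition is_face (R : realType) (V : vectType R) (P F : set V) :=
  exists (f : {scalar V}) (b : R),
    (forall x, P x -> f x <= b) /\ F = P `&` [set x | f x = b].

Definition is_partition (la : seq nat) : bool :=
  sorted geq la && all (fun m => 0 < m)%N la.

Definition partition_sub (la mu : seq nat) : Prop :=
  forall i, (nth 0 la i <= nth 0 mu i)%N.

(* delta n = (n-1, ..., 1) *)
Definition delta (n : nat) : seq nat := rev (iota 1 n.-1).

(* Rows, columns and parts are numbered from 0 here, so the 1-based condition
   n - la_i + 1 <= j <= n reads n - la_i <= j. *)
Definition in_diagram (n : nat) (la : seq nat) (i j : 'I_n) : bool :=
  (i < size la)%N && (n - nth 0 la i <= j)%N.

Definition ASM_polytope (R : realType) (n : nat) : set 'M[R]_n :=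
  [set a | [/\ forall i' j : 'I_n, 0 <= \sum_(i < n | (i <= i')%N) a i j <= 1,
               forall j' i : 'I_n, 0 <= \sum_(j < n | (j <= j')%N) a i j <= 1,
               forall i : 'I_n, \sum_(j < n) a i j = 1 &
               forall j : 'I_n, \sum_(i < n) a i j = 1]].

Definition P_lambda (R : realType) (n : nat) (la : seq nat) : set 'M[R]_n :=
  [set a | [/\ ASM_polytope a,
               forall i j : 'I_n, (j + 2 <= i)%N -> a i j = 0 &
               forall i j : 'I_n, in_diagram la i j -> a i j = 0]].

Definition ASMCRY (R : realType) (n : nat) : set 'M[R]_n := P_lambda [::].

Arguments ASM_polytope : clear implicits.
Arguments P_lambda : clear implicits.
Arguments ASMCRY : clear implicits.

(* Main.v *)
Require Import Defs.
From HB Require Import structures.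
From mathcomp Require Import all_boot all_order all_algebra.
From mathcomp Require Import zify lra.
From mathcomp Require Import classical_sets reals.

(** Both families of equations defining [P_lambda] say that column partial
    sums of an alternating sign matrix are extremal: the entries of a column
    below its subdiagonal position vanish iff the partial sums from that
    position on equal 1, and, [la] being a partition, the entries in the diagram
    vanish iff the partial sums there equal 0. Adding up these tight
    inequalities gives a supporting functional.

    For the dimension, the strictly upper entries outside [la] are free
    coordinates: a matrix supported on the diagonal and the subdiagonal with
    zero row and column sums is zero, since the positions form a path in the
    row/column incidence graph. Closing the free position (i, j) with i < j
    along this path gives the permutation matrix of a cycle on i, ..., j, so
    [P_lambda] contains the identity together with one affinely independent
    point for each free position. *)

Set Implicit Arguments.
Unset Strict Implicit.
Unset Printing Implicit Defensive.

Import Order.TTheory GRing.Theory Num.Theory.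

(** * Diagrams inside the staircase and the count of free positions *)

(** Past the last part [nth] returns 0 and the bound becomes [n <= j], which no ordinal
    satisfies. *)
Lemma in_diagramE n la (i j : 'I_n) :
  in_diagram la i j = (n - nth 0 la i <= j)%N.
Proof.
rewrite /in_diagram; case: ltnP => //= le_la_i.
by rewrite nth_default // subn0 leqNgt ltn_ord.
Qed.

Lemma nth_partition_le la i k : is_partition la -> (i <= k)%N ->
  (nth 0 la k <= nth 0 la i)%N.
Proof.
case/andP=> sorted_la _ le_ik; case: (ltnP k (size la)) => [lt_k|ge_k].
  apply: (sorted_leq_nth (leT := geq)) => //; last exact: leq_ltn_trans lt_k.
    by move=> x y z /= le1 le2; apply: leq_trans le2 le1.
  by move=> x /=.
by rewrite (nth_default _ ge_k).
Qed.

Lemma in_diagram_up n la (i k j : 'I_n) : is_partition la ->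
  (i <= k)%N -> in_diagram la k j -> in_diagram la i j.
Proof. by move=> la_part /(nth_partition_le la_part); rewrite !in_diagramE; lia. Qed.

Lemma partition_sub_delta n la i :
  partition_sub la (delta n) -> (nth 0 la i <= n.-1 - i)%N.
Proof.
move=> /(_ i) le_la; apply: leq_trans le_la _.
case: (ltnP i n.-1) => [lt_i|le_i].
  by rewrite nth_rev ?size_iota // nth_iota; lia.
by rewrite nth_default // size_rev size_iota.
Qed.

Lemma in_diagram_upper n la (i j : 'I_n) :
  partition_sub la (delta n) -> in_diagram la i j -> (i < j)%N.
Proof.
move=> /(partition_sub_delta i); rewrite in_diagramE.
by have := ltn_ord i; have := ltn_ord j; lia.
Qed.

(** A part with index [n.-1] would be positive, yet the staircase bounds it by 0. *)
Lemma size_partition_delta n la :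
  is_partition la -> partition_sub la (delta n) -> (size la <= n.-1)%N.
Proof.
case/andP=> _ /(all_nthP 0) pos_la /(partition_sub_delta n.-1).
by case: (leqP (size la)) => // /pos_la; lia.
Qed.

Definition free_positions n la : {pred 'I_n * 'I_n} :=
  [pred p : 'I_n * 'I_n | (p.1 < p.2)%N && ~~ in_diagram la p.1 p.2].

(** Count by rows: row i has [n.-1 - i] positions above the diagonal, and the diagram takes the last
    [nth 0 la i] of them. Containment in the staircase keeps every subtraction exact. *)
Lemma card_free_positions n la :
  is_partition la -> partition_sub la (delta n) ->
  #|@free_positions n la| = ('C(n, 2) - sumn la)%N.
Proof.
move=> la_part la_sub.
have -> : sumn la = \sum_(i < n) nth 0 la i.
  rewrite sumnE (big_nth 0) big_mkord.
  have le_size : (size la <= n)%N.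
    by apply: leq_trans (size_partition_delta la_part la_sub) (leq_pred _).
  rewrite (big_ord_widen n (fun i => nth 0 la i) le_size) big_mkcond /=.
  by apply: eq_bigr => i _; case: ltnP => // le_i; rewrite nth_default.
have -> : 'C(n, 2) = \sum_(i < n) (n.-1 - i).
  rewrite -bin2_sum big_mkord (reindex_inj rev_ord_inj) /=.
  by apply: eq_bigr => i _; lia.
suff -> : #|@free_positions n la| = \sum_(i < n) (n.-1 - i - nth 0 la i).
  rewrite -sumnB // => i _; exact: partition_sub_delta.
rewrite -sum1_card (eq_bigl (fun p : 'I_n * 'I_n =>
  predT p.1 && (p.1 < p.2 < n - nth 0 la p.1)%N)); last first.
  by move=> p; rewrite !inE in_diagramE -ltnNge.
rewrite -(pair_big_dep predT (fun i j : 'I_n => (i < j < n - nth 0 la i)%N)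
  (fun _ _ => 1)) /=.
apply: eq_bigr => i _.
(* Both conditions on j become the limits of one interval of naturals, whose length is the row
   count. *)
rewrite -(big_mkord (fun j => (i < j < n - nth 0 la i)%N) (fun _ => 1)).
rewrite -(big_nat_widen _ _ _ (fun j => i < j)) ?leq_subr //.
rewrite -(big_nat_widenl _ _ _ predT) // sum_nat_const_nat; lia.
Qed.

Local Open Scope ring_scope.

(** * Dimension: an affine frame of cycle matrices around the identity *)

Section Dimension.

Variables (R : realType) (n : nat).
Implicit Types (x : 'M[R]_n) (p : 'I_n * 'I_n) (la : seq nat).

(** The points [x0] and [x0 + v_i] already have the translate of [<<v>>] through [x0] as affine
    hull, and the bound on differences keeps the hull of [S] inside it. *)
Lemma has_dim_affine_frame (V : vectType R) (S : set V) (x0 : V) (k : nat)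
    (v : k.-tuple V) :
  S x0 -> (forall i : 'I_k, S (x0 + v`_i)) -> (forall y, S y -> y - x0 \in <<v>>%VS) ->
  free v -> has_dim S k.
Proof.
move=> Sx0 Sv sub_v free_v; exists x0, <<v>>%VS; split; last first.
  by move/eqP: free_v; rewrite size_tuple.
apply/seteqP; split=> [y [m [q [c [Sq c1 ->]]]]|y /= yv] /=.
  rewrite -[x0]scale1r -c1 scaler_suml -sumrB memv_suml // => i _.
  by rewrite -scalerBr memvZ // sub_v.
pose c i : R := coord v i (y - x0); pose s : R := \sum_i c i.
(* Index 0, where [unlift] gives [None], carries [x0] with the weight [1 - s] that completes the
   coordinates of [y - x0] to total 1. *)
exists k.+1, (fun i => oapp (fun j : 'I_k => x0 + v`_j) x0 (unlift ord0 i)).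
exists (fun i => oapp c (1 - s) (unlift ord0 i)).
split.
- by move=> i; case: unliftP => [j _|_] /=.
- rewrite big_ord_recl unlift_none /=.
  by under eq_bigr do rewrite liftK /=; rewrite subrK.
rewrite big_ord_recl unlift_none /=.
under eq_bigr => i _ do rewrite liftK /= scalerDr.
rewrite big_split /= -coord_span // -scaler_suml -/s addrA -scalerDl subrK scale1r.
by rewrite addrC subrK.
Qed.

Lemma sum_pred1_natr (r : pred 'I_n) :
  (exists i0, forall i, r i = (i == i0)) -> \sum_(i < n) (r i)%:R = 1 :> R.
Proof.
case=> i0 r_i0; rewrite (bigD1 i0) //= r_i0 eqxx big1 ?addr0 // => i /negPf.
by rewrite r_i0 => ->.
Qed.

Lemma partial_sum_itv (F : 'I_n -> R) (P : pred 'I_n) :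
  (forall i, 0 <= F i) -> \sum_i F i = 1 -> 0 <= \sum_(i | P i) F i <= 1.
Proof.
move=> F_ge0 <-; rewrite sumr_ge0 //=.
by rewrite (bigID P predT) /= lerDl sumr_ge0.
Qed.

Lemma ASM_polytope_perm (r : rel 'I_n) :
  (forall i, exists j0, forall j, r i j = (j == j0)) ->
  (forall j, exists i0, forall i, r i j = (i == i0)) ->
  ASM_polytope R n (\matrix_(i, j) (r i j)%:R).
Proof.
move=> r_row r_col.
have row1 i : \sum_j (\matrix_(i, j) (r i j)%:R) i j = 1 :> R.
  by under eq_bigr do rewrite mxE; apply: sum_pred1_natr.
have col1 j : \sum_i (\matrix_(i, j) (r i j)%:R) i j = 1 :> R.
  under eq_bigr do rewrite mxE; exact: (sum_pred1_natr (r := r^~ j)).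
split=> // i j; apply: partial_sum_itv => // k; rewrite mxE ler0n //.
Qed.

(** Induction on i + j, which numbers the path (0,0), (1,0), (1,1), (2,1), ...: a row sum settles
    each diagonal entry and a column sum each subdiagonal one, the other entry of that line having
    come earlier. *)
Lemma bidiagonal_eq0 x :
  (forall i j : 'I_n, i != j -> nat_of_ord i != j.+1 -> x i j = 0) ->
  x *m const_mx 1 = 0 :> 'cV_n -> const_mx 1 *m x = 0 :> 'rV_n -> x = 0.
Proof.
move=> supp row0 col0.
suff x0 m : forall i j : 'I_n, (i + j < m)%N -> x i j = 0.
  by apply/matrixP=> i j; rewrite mxE (x0 (i + j).+1).
elim: m => // m IHm i j lt_ij.
have [eq_ij|ne_ij] := eqVneq i j; last have [eq_iSj|] := eqVneq (i : nat) j.+1.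
- have /matrixP/(_ i 0) := row0; rewrite !mxE.
  under eq_bigr do rewrite mxE mulr1.
  rewrite (bigD1 j) //= big1 ?addr0 // => l ne_lj.
  have [eq_iSl|] := eqVneq (i : nat) l.+1; last by apply: supp; rewrite eq_ij eq_sym.
  by apply: IHm; move/(congr1 val): eq_ij => /=; lia.
- have /matrixP/(_ 0 j) := col0; rewrite !mxE.
  under eq_bigr do rewrite mxE mul1r.
  rewrite (bigD1 i) //= big1 ?addr0 // => l ne_li.
  have [eq_lj|ne_lj] := eqVneq l j; first by apply: IHm; rewrite eq_lj; lia.
  by apply: supp => //; rewrite -eq_iSj.
exact: supp.
Qed.

Lemma ASM_polytope_row_sum x :
  ASM_polytope R n x -> x *m const_mx 1 = const_mx 1 :> 'cV_n.
Proof.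
case=> _ _ row1 _; apply/matrixP=> i j; rewrite !mxE -[RHS](row1 i).
by apply: eq_bigr => k _; rewrite mxE mulr1.
Qed.

Lemma ASM_polytope_col_sum x :
  ASM_polytope R n x -> const_mx 1 *m x = const_mx 1 :> 'rV_n.
Proof.
case=> _ _ _ col1; apply/matrixP=> i j; rewrite !mxE -[RHS](col1 j).
by apply: eq_bigr => k _; rewrite mxE mul1r.
Qed.

(* For p = (i, j) with i < j, the permutation i -> j, k -> k - 1 for
   i < k <= j. *)
Definition cycle_rel p : rel 'I_n := fun k l =>
  if k == p.1 then l == p.2
  else if (p.1 < k <= p.2)%N then nat_of_ord k == l.+1 else k == l.

Definition cycle_mx p : 'M[R]_n := \matrix_(k, l) (cycle_rel p k l)%:R.

(** Only the jump from [p.1] to [p.2] goes above the diagonal, so the strictly upper entries act as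
    coordinates dual to the cycle matrices. *)
Lemma cycle_mx_upper p (k l : 'I_n) :
  (k < l)%N -> cycle_mx p k l = (p == (k, l))%:R.
Proof.
move=> lt_kl; rewrite mxE /cycle_rel -pair_eqE /= [p.1 == k]eq_sym [p.2 == l]eq_sym.
case: eqP => //= _; case: ifP => _; first by case: eqP => //; lia.
by case: eqP => // eq_kl; move: lt_kl; rewrite eq_kl ltnn.
Qed.

Lemma cycle_mx_lower p (k l : 'I_n) :
  (p.1 < p.2)%N -> (l + 2 <= k)%N -> cycle_mx p k l = 0.
Proof.
move=> lt_p lt_lk; rewrite mxE (_ : cycle_rel p k l = false) //.
by rewrite /cycle_rel -!val_eqE /=; do !case: ifP; lia.
Qed.

Lemma scaleBmxE (a : R) x y (k l : 'I_n) :
  (a *: (x - y)) k l = a * (x k l - y k l).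
Proof. by rewrite !mxE. Qed.

Lemma scalar_mx1_upper (k l : 'I_n) : (k < l)%N -> (1%:M : 'M[R]_n) k l = 0.
Proof. by move=> lt_kl; rewrite mxE -val_eqE /= ltn_eqF. Qed.

Lemma scalar_mx1_lower (k l : 'I_n) : (l + 2 <= k)%N -> (1%:M : 'M[R]_n) k l = 0.
Proof. by move=> lt_kl; rewrite mxE -val_eqE /= gtn_eqF //; lia. Qed.

Lemma ASM_polytope_cycle_mx p : (p.1 < p.2)%N -> ASM_polytope R n (cycle_mx p).
Proof.
case: p => i j /= lt_ij; have lt_jn := ltn_ord j.
apply: ASM_polytope_perm => [k|l]; rewrite /cycle_rel /=.
  have [_|_] := eqVneq k i; first by exists j.
  case: (boolP (i < k <= j)%N) => [/andP[lt_ik le_kj]|_]; last by exists k => l; rewrite eq_sym.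
  have lt_k1 : (k.-1 < n)%N by lia.
  by exists (Ordinal lt_k1) => l; rewrite -val_eqE /=; lia.
(* Columns invert the cycle: column j is hit from row i, column l with [i <= l < j] from row l + 1,
   any other from its own row. *)
have [->|ne_lj] := eqVneq l j.
  exists i => k; rewrite -!val_eqE /=; do !case: ifP => //; lia.
move: ne_lj; rewrite -val_eqE /= => ne_lj.
case: (boolP (i <= l < j)%N) => [/andP[le_il lt_lj]|out_l].
  have lt_l1 : (l.+1 < n)%N by lia.
  by exists (Ordinal lt_l1) => k; rewrite -!val_eqE /=; do !case: ifP => //; lia.
by exists l => k; rewrite -!val_eqE /=; do !case: ifP => //; lia.
Qed.

Lemma P_lambda_cycle_mx la p : partition_sub la (delta n) ->
  p \in free_positions la -> P_lambda R n la (cycle_mx p).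
Proof.
move=> la_sub /andP[/= lt_p nin_p]; split; first exact: ASM_polytope_cycle_mx.
  by move=> i j; apply: cycle_mx_lower.
move=> i j in_ij; rewrite cycle_mx_upper ?(in_diagram_upper la_sub) //.
by case: eqP nin_p => // -> /=; rewrite in_ij.
Qed.

Lemma P_lambda_scalar_mx1 la : partition_sub la (delta n) ->
  P_lambda R n la 1%:M.
Proof.
move=> la_sub; split.
- rewrite (_ : 1%:M = \matrix_(i, j) (i == j)%:R).
    by apply: ASM_polytope_perm => i; exists i => j //; rewrite eq_sym.
  by apply/matrixP=> i j; rewrite !mxE.
- exact: scalar_mx1_lower.
by move=> i j /(in_diagram_upper la_sub); apply: scalar_mx1_upper.
Qed.

(** Both sides have zero row and column sums and the same strictly upper entries, so
    [bidiagonal_eq0] applies to their difference. *)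
Lemma P_lambda_expansion la x : partition_sub la (delta n) ->
  P_lambda R n la x ->
  x - 1%:M = \sum_(p in free_positions la) x p.1 p.2 *: (cycle_mx p - 1%:M).
Proof.
move=> la_sub [ASMx lower0 diag0]; apply/eqP; rewrite -subr_eq0; apply/eqP.
have [ASM1 _ _] := P_lambda_scalar_mx1 la_sub.
apply: bidiagonal_eq0; last first.
- rewrite !mulmxBr mulmx_sumr !ASM_polytope_col_sum // subrr sub0r big1 ?oppr0 //.
  move=> p /andP[/ASM_polytope_cycle_mx ASMp _].
  by rewrite -scalemxAr mulmxBr !ASM_polytope_col_sum // subrr scaler0.
- rewrite !mulmxBl mulmx_suml !ASM_polytope_row_sum // subrr sub0r big1 ?oppr0 //.
  move=> p /andP[/ASM_polytope_cycle_mx ASMp _].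
  by rewrite -scalemxAl mulmxBl !ASM_polytope_row_sum // subrr scaler0.
move=> i j; rewrite -val_eqE /= => ne_ij ne_iSj.
rewrite mxE [X in _ + X]mxE summxE [(x - _) i j]mxE [X in _ + X - _]mxE.
have [lt_ij|le_ji] := ltnP i j; last first.
  have lt_ji : (j + 2 <= i)%N by lia.
  rewrite scalar_mx1_lower // lower0 // subr0 sub0r big1 ?oppr0 //.
  move=> p /andP[/= lt_p _].
  by rewrite scaleBmxE cycle_mx_lower // scalar_mx1_lower // subr0 mulr0.
rewrite scalar_mx1_upper // subr0.
have coefE p : (x p.1 p.2 *: (cycle_mx p - 1%:M)) i j =
    x p.1 p.2 * (p == (i, j))%:R.
  by rewrite scaleBmxE cycle_mx_upper // scalar_mx1_upper // subr0.
under eq_bigr do rewrite coefE.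
case: (boolP ((i, j) \in free_positions la)) => [ij_free|ij_free].
  rewrite (bigD1 (i, j)) //= eqxx mulr1 big1 ?addr0 ?subrr // => p.
  by case/andP=> _ /negPf->; rewrite mulr0.
rewrite big1 => [|p p_free]; last first.
  by case: eqP p_free ij_free => [->->|_ _ _] //; rewrite mulr0.
by rewrite subr0 diag0 //; move: ij_free; rewrite inE /= lt_ij negbK.
Qed.

Lemma has_dim_P_lambda la : is_partition la -> partition_sub la (delta n) ->
  has_dim (P_lambda R n la) ('C(n, 2) - sumn la).
Proof.
move=> la_part la_sub; rewrite -card_free_positions //.
set k := #|_|; pose q (i : 'I_k) : 'I_n * 'I_n := enum_val i.
have q_free i : q i \in free_positions la by apply: enum_valP.
pose v : k.-tuple 'M[R]_n := [tuple cycle_mx (q i) - 1%:M | i < k].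
have vE (i : 'I_k) : v`_i = cycle_mx (q i) - 1%:M by rewrite -tnth_nth tnth_mktuple.
apply: (has_dim_affine_frame (x0 := 1%:M) (v := v)).
- exact: P_lambda_scalar_mx1.
- by move=> i; rewrite vE addrC subrK; apply: P_lambda_cycle_mx.
- move=> y /(P_lambda_expansion la_sub) ->; apply: memv_suml => p p_free.
  rewrite memvZ // memv_span //; apply/tnthP; exists (enum_rank_in p_free p).
  by rewrite tnth_mktuple /q enum_rankK_in.
(* Evaluating the relation at position [q i] isolates the coefficient [c i]. *)
apply/freeP=> c sum_c i; have /andP[/= lt_q _] := q_free i.
have /matrixP/(_ (q i).1 (q i).2) := sum_c; rewrite summxE mxE (bigD1 i) //= vE.
rewrite scaleBmxE cycle_mx_upper // scalar_mx1_upper // -surjective_pairing eqxx.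
rewrite subr0 mulr1 big1 ?addr0 // => j ne_ji.
rewrite vE scaleBmxE cycle_mx_upper // scalar_mx1_upper // -surjective_pairing.
by rewrite (inj_eq enum_val_inj) (negPf ne_ji) subr0 mulr0.
Qed.

End Dimension.

(** * Face: a supporting functional built from column partial sums *)

Section Face.

Variables (R : realType) (n : nat).
Implicit Types (x w : 'M[R]_n) (la : seq nat).

Definition col_psum x (i j : 'I_n) : R := \sum_(k < n | (k <= i)%N) x k j.

Definition col_psum_form w x : R := \sum_p w p.1 p.2 * col_psum x p.1 p.2.

Lemma col_psum_form_is_scalar w : scalar (col_psum_form w).
Proof.
move=> a x y; rewrite /col_psum_form mulr_sumr -big_split /=.
apply: eq_bigr => p _; rewrite mulrCA -mulrDr; congr (_ * _).
by rewrite /col_psum mulr_sumr -big_split; apply: eq_bigr => k _; rewrite !mxE.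
Qed.

HB.instance Definition _ w :=
  GRing.isLinear.Build R 'M[R]_n R *%R (col_psum_form w)
    (col_psum_form_is_scalar w).

Lemma col_psum_split x (i j : 'I_n) :
  col_psum x i j = x i j + \sum_(k < n | (k < i)%N) x k j.
Proof.
rewrite /col_psum (bigD1 i) //=; congr (_ + _); apply: eq_bigl => k.
by rewrite -val_eqE /=; lia.
Qed.

Lemma col_psum_pred x (i i' j : 'I_n) : i = i'.+1 :> nat ->
  col_psum x i j = x i j + col_psum x i' j.
Proof. by move=> eq_i; rewrite col_psum_split eq_i. Qed.

Lemma P_lambdaE la x :
  is_partition la -> ASM_polytope R n x ->
  P_lambda R n la x <->
  (forall i j : 'I_n, (j < i)%N -> col_psum x i j = 1) /\
  (forall i j : 'I_n, in_diagram la i j -> col_psum x i j = 0).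
Proof.
move=> la_part ASMx; split=> [[_ lower0 diag0]|[psum1 psum0]].
  split=> i j ij; last by apply: big1 => k le_ki; apply/diag0/in_diagram_up/ij.
  case: ASMx => _ _ _ /(_ j) <-.
  rewrite [RHS](bigID (fun k : 'I_n => k <= i)%N) /= [X in _ + X]big1 ?addr0 //.
  by move=> k lt_ik; apply: lower0; lia.
split=> // i j ij.
  (* As [j + 2 <= i], row i - 1 is still strictly below the diagonal, so the entry is a difference
     of two partial sums equal to 1. *)
  have lt_i1 : (i.-1 < n)%N by have := ltn_ord i; lia.
  have := @col_psum_pred x i (Ordinal lt_i1) j; rewrite !psum1 /=; try lia.
  by move=> /(_ ltac:(lia)); lra.
(* In row 0 the partial sum is the entry itself; further down, the row above is also in the
   diagram. *)
have [i0|i_gt0] := posnP i.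
  have := psum0 i j ij; rewrite col_psum_split big_pred0 ?addr0 // => k.
  by rewrite i0.
have lt_i1 : (i.-1 < n)%N by have := ltn_ord i; lia.
have in_i1 : in_diagram la (Ordinal lt_i1) j.
  by apply: in_diagram_up ij => //=; lia.
have := @col_psum_pred x i (Ordinal lt_i1) j; rewrite !psum0 //=.
by move=> /(_ ltac:(lia)); lra.
Qed.

Lemma is_face_P_lambda la : is_partition la -> partition_sub la (delta n) ->
  is_face (ASM_polytope R n) (P_lambda R n la).
Proof.
move=> la_part la_sub.
(* Weight 1 encodes the bound [col_psum <= 1] below the diagonal, weight -1 the bound
   [0 <= col_psum] on the diagram; [b] adds up the right-hand sides and [slack] is the gap in each
   inequality. *)
pose w : 'M[R]_n := \matrix_(i, j) ((j < i)%N%:R - (in_diagram la i j)%:R).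
pose b : R := \sum_(p : 'I_n * 'I_n) (p.2 < p.1)%N%:R.
pose slack x (p : 'I_n * 'I_n) :=
  (p.2 < p.1)%N%:R - w p.1 p.2 * col_psum x p.1 p.2.
have slackE x : b - col_psum_form w x = \sum_p slack x p by rewrite -sumrB.
have slack_lower x (i j : 'I_n) : (j < i)%N -> slack x (i, j) = 1 - col_psum x i j.
  move=> lt_ji; rewrite /slack mxE /= lt_ji.
  case: (boolP (in_diagram la i j)) => [/(in_diagram_upper la_sub)|_]; first lia.
  by rewrite subr0 mul1r.
have slack_diag x (i j : 'I_n) : in_diagram la i j -> slack x (i, j) = col_psum x i j.
  move=> in_ij; rewrite /slack mxE /= in_ij.
  have /ltnW := in_diagram_upper la_sub in_ij; rewrite leqNgt => /negPf ->.
  by rewrite !sub0r mulN1r opprK.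
have slack_other x (i j : 'I_n) : ~~ (j < i)%N -> ~~ in_diagram la i j ->
    slack x (i, j) = 0.
  by rewrite /slack mxE /= => /negPf-> /negPf->; rewrite subrr mul0r subr0.
have slack_ge0 x : ASM_polytope R n x -> forall p, 0 <= slack x p.
  move=> [psum_itv _ _ _] [i j]; have /andP[psum_ge0 psum_le1] := psum_itv i j.
  case: (boolP (j < i)%N) => [/slack_lower->|not_lower]; first by rewrite subr_ge0.
  by case: (boolP (in_diagram la i j)) => [/slack_diag->|/slack_other->].
exists (col_psum_form w), b; split=> [x ASMx|].
  by rewrite -subr_ge0 slackE sumr_ge0 // => p _; apply: slack_ge0.
apply/seteqP; split=> [x Px|x [/= ASMx fx]].
  have [ASMx _ _] := Px; split=> //=; apply/esym/eqP.
  have [psum1 psum0] := (P_lambdaE la_part ASMx).1 Px.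
  rewrite -subr_eq0 slackE big1 // => -[i j] _.
  case: (boolP (j < i)%N) => [lt_ji|not_lower].
    by rewrite slack_lower // psum1 // subrr.
  case: (boolP (in_diagram la i j)) => [in_ij|]; last exact: slack_other.
  by rewrite slack_diag // psum0.
(* Equality in the summed inequality forces each nonnegative gap to vanish. *)
have slack0 p : slack x p = 0.
  have := slackE x; rewrite fx subrr => /esym/eqP.
  rewrite psumr_eq0 => [/allP/(_ p)|q _]; last exact: slack_ge0.
  by rewrite mem_index_enum => /(_ isT)/eqP.
apply/(P_lambdaE la_part ASMx); split=> i j ij.
  by apply/esym/eqP; rewrite -subr_eq0 -slack_lower // slack0.
by rewrite -slack_diag // slack0.
Qed.

End Face.

Theorem theorem4p3 (R : realType) (n : nat) (n_ge1 : (1 <= n)%N) :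
  (forall la : seq nat, is_partition la -> partition_sub la (delta n) ->
     is_face (ASM_polytope R n) (P_lambda R n la) /\
     has_dim (P_lambda R n la) ('C(n, 2) - sumn la)%N) /\
  (is_face (ASM_polytope R n) (ASMCRY R n) /\
   has_dim (ASMCRY R n) 'C(n, 2)).
Proof.
have main la : is_partition la -> partition_sub la (delta n) ->
    is_face (ASM_polytope R n) (P_lambda R n la) /\
    has_dim (P_lambda R n la) ('C(n, 2) - sumn la)%N.
  by move=> la_part la_sub; split;
    [apply: is_face_P_lambda | apply: has_dim_P_lambda].
split=> //; rewrite -['C(n, 2)]subn0; apply: (main [::]) => //.
by move=> i; rewrite nth_nil.
Qed.
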